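(* Each of the four domains in $\mathbb{C}^4$ $$D^{>}_{\pm}:=\{(z_1,z_2,z_3,z_4)\in\mathbb{C}^4:\ \mathrm{Re}\,z_4>z_1\overline{z_2}+z_2\overline{z_1}+|z_3|^2\pm|z_1|^4\},$$ $$D^{<}_{\pm}:=\{(z_1,z_2,z_3,z_4)\in\mathbb{C}^4:\ \mathrm{Re}\,z_4<z_1\overline{z_2}+z_2\overline{z_1}+|z_3|^2\pm|z_1|^4\}$$ is holomorphically homogeneous and is not biholomorphically equivalent to any bounded domain.
   Context: The upper sign is taken for $D^{>}_{+},D^{<}_{+}$ and the lower sign for $D^{>}_{-},D^{<}_{-}$. A domain $D\subset\mathbb{C}^n$ is holomorphically homogeneous if its group of holomorphic automorphisms (biholomorphic maps of $D$ onto itself) acts transitively on $D$. *)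

(* Defs.v *)
From HB Require Import structures.
From mathcomp Require Import all_boot all_order all_algebra.
From mathcomp Require Import complex.
From mathcomp Require Import all_classical all_reals all_analysis.

Set Implicit Arguments.
Unset Strict Implicit.
Unset Printing Implicit Defensive.

Import Order.TTheory GRing.Theory Num.Theory.
Import numFieldNormedType.Exports.

Local Open Scope classical_set_scope.
Local Open Scope ring_scope.

(* R[i] carries the usual topology and is a normed module over itself, so that
   [differentiable] between spaces 'rV[R[i]]_n means complex (Frechet)
   differentiable: the differential is R[i]-linear. *)
HB.instance Definition _ (R : rcfType) :=
  PseudoPointedMetric.copy R[i] (R[i] : numClosedFieldType)^o.
HB.instance Definition _ (R : rcfType) :=
  NormedModule.copy R[i] (R[i] : numClosedFieldType)^o.

Definition is_domain (R : realType) (n : nat) (D : set 'rV[R[i]]_n) : Prop :=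
  [/\ D !=set0, open D & connected D].

(* Only used for D open, so the values of f outside D play no role. *)
Definition holomorphic_on (R : realType) (n m : nat) (D : set 'rV[R[i]]_n)
    (f : 'rV[R[i]]_n -> 'rV[R[i]]_m) : Prop :=
  forall z, D z -> differentiable f z.

Definition biholomorphism (R : realType) (n m : nat) (D : set 'rV[R[i]]_n)
    (U : set 'rV[R[i]]_m) (f : 'rV[R[i]]_n -> 'rV[R[i]]_m) : Prop :=
  set_bij D U f /\ holomorphic_on D f /\
  exists g : 'rV[R[i]]_m -> 'rV[R[i]]_n,
    holomorphic_on U g /\ (forall z, D z -> g (f z) = z).

Definition biholomorphic (R : realType) (n m : nat) (D : set 'rV[R[i]]_n)
    (U : set 'rV[R[i]]_m) : Prop :=
  exists f : 'rV[R[i]]_n -> 'rV[R[i]]_m, biholomorphism D U f.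

Definition holomorphically_homogeneous (R : realType) (n : nat)
    (D : set 'rV[R[i]]_n) : Prop :=
  is_domain D /\
  forall p q, D p -> D q -> exists2 f, biholomorphism D D f & f p = q.

(* The coordinates z_1, ..., z_4 are z 0 0, ..., z 0 3. All the quantities
   compared below are real elements of R[i], on which the (partial) order of
   R[i] is the order of R. *)
Definition model_rhs (R : realType) (e : R[i]) (z : 'rV[R[i]]_4) : R[i] :=
  z 0 0 * (z 0 1)^* + z 0 1 * (z 0 0)^* + `|z 0 2| ^+ 2 + e * `|z 0 0| ^+ 4.

Definition Dgt (R : realType) (e : R[i]) : set 'rV[R[i]]_4 :=
  [set z : 'rV[R[i]]_4 | 'Re (z 0 3) > model_rhs e z].

Definition Dlt (R : realType) (e : R[i]) : set 'rV[R[i]]_4 :=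
  [set z : 'rV[R[i]]_4 | 'Re (z 0 3) < model_rhs e z].

(* Main.v *)
Require Import Defs.
From mathcomp Require Import all_boot all_order all_algebra.
From mathcomp Require Import complex ring lra.
From mathcomp Require Import all_classical all_reals all_analysis.
Import Order.TTheory GRing.Theory Num.Theory.
Import numFieldNormedType.Exports.
Import ComplexField.Normc.
Local Open Scope classical_set_scope.
Local Open Scope ring_scope.

Set Implicit Arguments.
Unset Strict Implicit.
Unset Printing Implicit Defensive.

(** Let [height e z] be the real number Re z_4 - (2 Re (z_1 conj z_2)
    + |z_3|^2 + e |z_1|^4), with e = 1 or -1; the four domains are the sets
    where it is positive, or negative.

    Homogeneity.  Three families of polynomial automorphisms of C^4 act on the
    levels of the height.  [translation] moves z_2, z_3 and Im z_4, and
    [shear] moves z_1; both preserve the height, because every term that the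
    move creates in the model function is either the real part of a
    holomorphic polynomial, which z_4 absorbs, or the real part of conj z_1
    times such a polynomial, which z_2 absorbs.  Together they bring any point
    to (0, 0, 0, height) ([normal_form]).  The weighted [dilation] by s
    multiplies the height by s^4, so it joins two such normal forms whose
    heights have the same sign ([homogeneous_height]).

    No bounded model.  Each domain contains a complex line z |-> (0, z, 0, d),
    on which the height is constant.  A biholomorphism onto a bounded domain
    would be bounded and entire on it, hence constant by Liouville's theorem,
    and so not injective ([bounded_not_biholomorphic]).

    Liouville's theorem is proved here for functions that are only assumed to
    be complex differentiable, without any integral.  Integrals along a side of
    a square are replaced by iterated trapezoid means ([segment_mean]), defined
    by halving the side, so that the circulation of f around a square is
    exactly the sum of the circulations around its four quarters
    ([circulationS]) and is exactly zero for affine f.  Goursat's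
    quartering argument then shows that the circulations of a differentiable
    function tend to zero as the mesh is refined ([goursat]), and this survives
    a point near which the function is only bounded ([goursat_bounded]).
    For an entire p that tends to zero at infinity, apply this to
    (p z - p 0) / z on large squares: the part p z / z has small circulation,
    while that of 1 / z stays away from zero, so p 0 = 0 ([entire_zero]).
    For a bounded entire f the function (f z - f 0)^2 / z is entire and tends
    to zero at infinity, hence is identically zero ([liouville]). *)


Local Notation "x %:C" := (real_complex _ x) : ring_scope.
Local Notation Re := complex.Re.
Local Notation Im := complex.Im.

(** * Modulus, real and imaginary parts *)

Section complex_parts.
Variable R : realType.
Local Notation I := ('i%C : R[i]).
Implicit Types z w : R[i].

Lemma normCE z : `|z| = (normc z)%:C.
Proof. by case: z. Qed.

Lemma normc_real (x : R) : normc x%:C = `|x|.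
Proof. by rewrite /= expr0n addr0 sqrtr_sqr. Qed.

Lemma normc_i : normc I = 1.
Proof. by rewrite /= expr0n add0r expr1n sqrtr1. Qed.

Lemma normc_ge0 z : 0 <= normc z.
Proof. by case: z => x y; exact: sqrtr_ge0. Qed.

Lemma normc_half z : normc (z / 2) = normc z / 2.
Proof.
have -> : (2 : R[i])^-1 = (2^-1)%:C by rewrite fmorphV rmorph_nat.
by rewrite normcM normc_real ger0_norm // invr_ge0.
Qed.

Lemma ReD z w : Re (z + w) = Re z + Re w.
Proof. by case: z; case: w. Qed.

Lemma ImD z w : Im (z + w) = Im z + Im w.
Proof. by case: z; case: w. Qed.

Lemma ReN z : Re (- z) = - Re z.
Proof. by case: z. Qed.

Lemma ImN z : Im (- z) = - Im z.
Proof. by case: z. Qed.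

Lemma ImM z w : Im (z * w) = Re z * Im w + Im z * Re w.
Proof. by case: z; case: w. Qed.

Lemma Re_half z : Re (z / 2) = Re z / 2.
Proof.
have -> : (2 : R[i])^-1 = (2^-1)%:C by rewrite fmorphV rmorph_nat.
by case: z => x y /=; rewrite mulr0 subr0.
Qed.

Lemma Im_half z : Im (z / 2) = Im z / 2.
Proof.
have -> : (2 : R[i])^-1 = (2^-1)%:C by rewrite fmorphV rmorph_nat.
by case: z => x y /=; rewrite mulr0 add0r.
Qed.

Lemma Re_iM z : Re (I * z) = - Im z.
Proof. by case: z => x y /=; rewrite mul0r mul1r sub0r. Qed.

Lemma Im_iM z : Im (I * z) = Re z.
Proof. by case: z => x y /=; rewrite mul0r mul1r add0r. Qed.

Lemma Re_inv z : Re z^-1 = Re z / (Re z ^+ 2 + Im z ^+ 2).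
Proof. by case: z. Qed.

Lemma Im_inv z : Im z^-1 = - Im z / (Re z ^+ 2 + Im z ^+ 2).
Proof. by case: z => x y /=; rewrite mulNr. Qed.

Lemma normc_geRe z : `|Re z| <= normc z.
Proof.
case: z => x y /=; rewrite -sqrtr_sqr ler_wsqrtr // lerDl sqr_ge0 //.
Qed.

Lemma normc_geIm z : `|Im z| <= normc z.
Proof.
case: z => x y /=; rewrite -sqrtr_sqr ler_wsqrtr // lerDr sqr_ge0 //.
Qed.

Lemma normc_le_ReIm z : normc z <= `|Re z| + `|Im z|.
Proof.
rewrite [z in normc z](_ : z = (Re z)%:C + I * (Im z)%:C); last first.
  exact: complexE.
by apply: le_trans (le_normcD _ _) _; rewrite normcM normc_i mul1r !normc_real.
Qed.

End complex_parts.

(** * Trapezoid means and circulations *)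

Section circulations.
Variable R : realType.
Local Notation I := ('i%C : R[i]).
Implicit Types (f g : R[i] -> R[i]) (a h z : R[i]) (P K : set R[i]).

(** The trapezoid rule with 2^n steps for the mean of [f] over the segment
    from [a] to [a + h].  Recursion on halves makes additivity under bisection
    hold by definition, at every finite level. *)
Fixpoint segment_mean f n a h : R[i] :=
  if n is m.+1 then
    (segment_mean f m a (h / 2) + segment_mean f m (a + h / 2) (h / 2)) / 2
  else (f a + f (a + h)) / 2.

Definition midconvex (P : set R[i]) := forall x y, P x -> P y -> P ((x + y) / 2).

(** A dyadic mean is built from values of [f] by midpoints only, so it stays in
    any midpoint-convex set that contains these values.  Every estimate below
    comes from this, with [P] a square or a half-plane that contains the
    segment and [K] a disc or a half-plane. *)
Lemma segment_mean_in (P K : set R[i]) f n a h : midconvex P -> midconvex K ->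
  (forall z, P z -> K (f z)) -> P a -> P (a + h) -> K (segment_mean f n a h).
Proof.
move=> mP mK PK; elim: n a h => [|n IH] a h Pa Pah /=; first by apply: mK; exact: PK.
have Pm : P (a + h / 2).
  by rewrite [X in P X](_ : _ = (a + (a + h)) / 2); [exact: mP|field].
apply: mK; apply: IH => //.
by rewrite -addrA -splitr.
Qed.

Lemma segment_meanD f g n a h :
  segment_mean (fun z => f z + g z) n a h =
  segment_mean f n a h + segment_mean g n a h.
Proof. by elim: n a h => [|n IH] a h /=; rewrite ?IH; field. Qed.

Lemma segment_meanZ c f n a h :
  segment_mean (fun z => c * f z) n a h = c * segment_mean f n a h.
Proof. by elim: n a h => [|n IH] a h /=; rewrite ?IH; field. Qed.

Lemma segment_mean_affine c d n a h :
  segment_mean (fun z => c + d * z) n a h = c + d * (a + h / 2).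
Proof. by elim: n a h => [|n IH] a h /=; rewrite ?IH; field. Qed.

(** The discrete counterpart of the integral of [f] dz around the square with
    lower left corner [a] and side [s], counterclockwise; the top and left
    sides are traversed backwards and so enter with a minus sign. *)
Definition circulation f n a (s : R) : R[i] :=
  s%:C * (segment_mean f n a s%:C + I * segment_mean f n (a + s%:C) (I * s%:C)
   - segment_mean f n (a + I * s%:C) s%:C - I * segment_mean f n a (I * s%:C)).

(** Inner sides of the quarters are traversed twice, in opposite directions,
    with the same sample points, so they cancel exactly. *)
Lemma circulationS f n a s : circulation f n.+1 a s =
  circulation f n a (s / 2) + circulation f n (a + (s / 2)%:C) (s / 2)
  + circulation f n (a + I * (s / 2)%:C) (s / 2)
  + circulation f n (a + (s / 2)%:C + I * (s / 2)%:C) (s / 2).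
Proof.
rewrite /circulation /=; set t := (s / 2)%:C.
have -> : s%:C = t + t by rewrite -rmorphD -splitr.
have -> : (t + t) / 2 = t by field.
have -> : I * (t + t) / 2 = I * t by field.
have -> : a + (t + t) + I * t = a + t + I * t + t by ring.
have -> : a + I * (t + t) + t = a + t + I * t + I * t by ring.
have -> : a + I * (t + t) = a + I * t + I * t by ring.
have -> : a + (t + t) = a + t + t by ring.
have -> : a + I * t + t = a + t + I * t by ring.
by field; rewrite ?pnatr_eq0.
Qed.

Lemma circulationD f g n a s :
  circulation (fun z => f z + g z) n a s =
  circulation f n a s + circulation g n a s.
Proof. by rewrite /circulation !segment_meanD; ring. Qed.

Lemma circulationZ c f n a s :
  circulation (fun z => c * f z) n a s = c * circulation f n a s.
Proof. by rewrite /circulation !segment_meanZ; ring. Qed.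

(** The trapezoid rule is exact for affine functions, so only the error of the
    first order expansion contributes in Goursat's argument. *)
Lemma circulation_affine c d n a s : circulation (fun z => c + d * z) n a s = 0.
Proof. by rewrite /circulation !segment_mean_affine; field. Qed.

Lemma midconvex_ball (M : R) : midconvex [set z | normc z <= M].
Proof.
move=> x y /= xM yM; rewrite normc_half.
have := le_normcD x y; lra.
Qed.

Lemma segment_mean_le (P : set R[i]) f (M : R) n a h : midconvex P ->
  (forall z, P z -> normc (f z) <= M) -> P a -> P (a + h) ->
  normc (segment_mean f n a h) <= M.
Proof. by move=> mP PM; apply: segment_mean_in (@midconvex_ball M) PM. Qed.

Definition square a (s : R) : set R[i] := [set z |
  Re a <= Re z <= Re a + s /\ Im a <= Im z <= Im a + s].

Lemma midconvex_square a s : midconvex (square a s).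
Proof.
move=> x y; rewrite /square /= Re_half Im_half ReD ImD.
move=> [/andP[? ?] /andP[? ?]] [/andP[? ?] /andP[? ?]].
by split; apply/andP; split; lra.
Qed.

Lemma circulation_le4 f n a (s M1 M2 M3 M4 : R) : 0 <= s ->
  normc (segment_mean f n a s%:C) <= M1 ->
  normc (segment_mean f n (a + s%:C) (I * s%:C)) <= M2 ->
  normc (segment_mean f n (a + I * s%:C) s%:C) <= M3 ->
  normc (segment_mean f n a (I * s%:C)) <= M4 ->
  normc (circulation f n a s) <= s * (M1 + M2 + M3 + M4).
Proof.
move=> s0 h1 h2 h3 h4; rewrite /circulation normcM normc_real ger0_norm //.
apply: ler_wpM2l => //.
apply: le_trans (le_normcD _ _) _; rewrite normcN normcM normc_i mul1r.
apply: lerD => //; apply: le_trans (le_normcD _ _) _; rewrite normcN.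
apply: lerD => //; apply: le_trans (le_normcD _ _) _; rewrite normcM normc_i mul1r.
exact: lerD.
Qed.

Lemma circulation_le f n a (s M : R) : 0 <= s ->
  (forall z, square a s z -> normc (f z) <= M) ->
  normc (circulation f n a s) <= 4 * s * M.
Proof.
move=> s0 fM.
have -> : 4 * s * M = s * (M + M + M + M) by ring.
by apply: circulation_le4 => //; apply: (segment_mean_le (P := square a s)) => //;
  try exact: midconvex_square;
  rewrite /square /= ?ReD ?ImD ?Re_iM ?Im_iM /=;
  split; apply/andP; split; lra.
Qed.

(** * Goursat's theorem *)

(** Complex differentiability with real epsilon and delta, so that real
    arithmetic decides the estimates. *)
Definition has_cderiv f z0 d := forall e : R, 0 < e -> exists2 r : R, 0 < r &
  forall z, normc (z - z0) < r ->
    normc (f z - f z0 - d * (z - z0)) <= e * normc (z - z0).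

Definition vanishing (u : nat -> R[i]) :=
  forall e : R, 0 < e -> exists N, forall n, (N <= n)%N -> normc (u n) <= e.

Lemma vanishingD u v : vanishing u -> vanishing v -> vanishing (fun n => u n + v n).
Proof.
move=> hu hv e e0; have e20 : 0 < e / 2 by rewrite divr_gt0.
have [N uN] := hu _ e20; have [N' vN] := hv _ e20.
exists (maxn N N') => n; rewrite geq_max => /andP[nN nN'].
apply: le_trans (le_normcD _ _) _; rewrite [leRHS]splitr.
by apply: lerD; [exact: uN|exact: vN].
Qed.

Lemma vanishing_ext (u v : nat -> R[i]) : u =1 v -> vanishing u -> vanishing v.
Proof. by move=> /funext ->. Qed.

Lemma vanishing_shift (u : nat -> R[i]) k :
  vanishing u -> vanishing (fun n => u (n + k)%N).
Proof.
by move=> hu e /hu[N hN]; exists N => n Nn; apply/hN/(leq_trans Nn)/leq_addr.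
Qed.

Lemma nested_point (u r : nat -> R) :
  (forall k, u k <= u k.+1) -> (forall k, u k.+1 + r k.+1 <= u k + r k) ->
  (forall k, 0 <= r k) -> exists x, forall k, u k <= x <= u k + r k.
Proof.
move=> hu hv hr.
have mu i j : (i <= j)%N -> u i <= u j.
  by move=> /subnK <-; elim: (j - i)%N => [|k IH] //; exact: le_trans IH (hu _).
have mv i j : (i <= j)%N -> u j + r j <= u i + r i.
  by move=> /subnK <-; elim: (j - i)%N => [|k IH] //; exact: le_trans (hv _) IH.
have uv i j : u i <= u j + r j.
  have [ij|/ltnW ji] := leqP i j.
    by apply: le_trans (mu _ _ ij) _; rewrite lerDl.
  by apply: le_trans (mv _ _ ji); rewrite lerDl.
exists (sup (range u)) => k; apply/andP; split.
  apply: ub_le_sup; last by exists k.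
  by exists (u 0%N + r 0%N) => _ [j _ <-].
apply: ge_sup; first by exists (u 0%N), 0%N.
by move=> _ [j _ <-].
Qed.

Definition subsquare b t a s :=
  [/\ Re a <= Re b, Re b + t <= Re a + s, Im a <= Im b & Im b + t <= Im a + s].

(** The negation of smallness in the limit: refining the mesh does not bring
    the circulation below [e]. *)
Definition resistant f e a s :=
  forall N, exists2 n, (N <= n)%N & e < normc (circulation f n a s).

(** The circulation at level n.+1 is the sum of four circulations at level n;
    if each of them were eventually at most [e / 4], the sum would eventually be
    at most [e]. *)
Lemma resistant_quarter f e a s : 0 < s -> resistant f e a s ->
  exists b, resistant f (e / 4) b (s / 2) /\ subsquare b (s / 2) a s.
Proof.
move=> s0 bad.
have tame b : ~ resistant f (e / 4) b (s / 2) ->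
    exists N, forall n, (N <= n)%N -> normc (circulation f n b (s / 2)) <= e / 4.
  move=> /existsNP[N hN]; exists N => n nN; rewrite leNgt; apply/negP => lt.
  by apply: hN; exists n.
apply: contrapT => /forallNP none.
have good b : subsquare b (s / 2) a s ->
    exists N, forall n, (N <= n)%N -> normc (circulation f n b (s / 2)) <= e / 4.
  by move=> hb; apply: tame => bb; exact: (none b).
have [|N1 h1] := good a; first by rewrite /subsquare; split; lra.
have [|N2 h2] := good (a + (s / 2)%:C);
  first by rewrite /subsquare ?ReD ?ImD /=; split; lra.
have [|N3 h3] := good (a + I * (s / 2)%:C);
  first by rewrite /subsquare ?ReD ?ImD ?Re_iM ?Im_iM /=; split; lra.
have [|N4 h4] := good (a + (s / 2)%:C + I * (s / 2)%:C);
  first by rewrite /subsquare ?ReD ?ImD ?Re_iM ?Im_iM /=; split; lra.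
have [[//|n]] := bad (maxn (maxn N1 N2) (maxn N3 N4)).+1.
rewrite ltnS !geq_max => /andP[/andP[n1 n2] /andP[n3 n4]].
rewrite circulationS ltNge => /negP; apply.
move: (h1 _ n1) (h2 _ n2) (h3 _ n3) (h4 _ n4) => {}h1 {}h2 {}h3 {}h4.
set c1 := circulation f n a _ in h1 *; set c2 := circulation f n (a + _) _ in h2 *.
set c3 := circulation f n (a + I * _) _ in h3 *.
apply: le_trans (le_normcD _ _) _.
have := le_normcD (c1 + c2) c3; have := le_normcD c1 c2; lra.
Qed.

(** A square whose circulations resist [e] contains nested squares of side
    s / 2^k that resist e / 4^k.  At their common point z0 the function is
    affine up to an error o(|z - z0|), which on the k-th square gives a
    circulation of o(1) times the square of its side, for every mesh at once:
    less than e / 4^k for k large. *)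
Theorem goursat f a (s : R) : 0 < s ->
  (forall z, square a s z -> exists d, has_cderiv f z d) ->
  vanishing (fun n => circulation f n a s).
Proof.
move=> s0 df; apply: contrapT => /existsNP[e /not_implyP[e0 /forallNP bad]].
have {}bad : resistant f e a s.
  move=> N; have /existsNP[n /not_implyP[nN /negP]] := bad N.
  by rewrite -ltNge; exists n.
pose child (p : R[i] * nat) b := resistant f (e / 4 ^+ p.2) p.1 (s / 2 ^+ p.2) ->
  resistant f (e / 4 ^+ p.2.+1) b (s / 2 ^+ p.2.+1) /\
  subsquare b (s / 2 ^+ p.2.+1) p.1 (s / 2 ^+ p.2).
have [|F hF] := @choice _ _ child.
  move=> p; rewrite /child.
  have [bp|] := pselect (resistant f (e / 4 ^+ p.2) p.1 (s / 2 ^+ p.2));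
    last by exists 0.
  have [|b] := resistant_quarter _ bp; first by rewrite divr_gt0 // exprn_gt0.
  by rewrite !exprSr !invfM !mulrA; exists b.
pose b := fix b k := if k is j.+1 then F (b j, j) else a.
have badb k : resistant f (e / 4 ^+ k) (b k) (s / 2 ^+ k).
  elim: k => [|k IH] /=; first by rewrite !expr0 !divr1.
  by have [] := hF (b k, k) IH.
have r0 k : 0 <= s / 2 ^+ k by rewrite divr_ge0 ?exprn_ge0 // ltW.
have [x hx] : exists x, forall k, Re (b k) <= x <= Re (b k) + s / 2 ^+ k.
  by apply: nested_point => // k; have [_ []] := hF (b k, k) (badb k).
have [y hy] : exists y, forall k, Im (b k) <= y <= Im (b k) + s / 2 ^+ k.
  by apply: nested_point => // k; have [_ []] := hF (b k, k) (badb k).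
pose z0 := Complex x y.
have z0in k : square (b k) (s / 2 ^+ k) z0 by [].
have [|d hd] := df z0.
  by have := z0in 0%N; rewrite expr0 divr1.
(* On a square of side t, an error of modulus e' * (2 * t) has circulation at
   most 8 * e' * t ^ 2; with t = s / 2 ^ k and this e', that is e / 4 ^ k / 2. *)
have [|r rgt0 hr] := hd (e / (16 * s ^+ 2)).
  by rewrite divr_gt0 // mulr_gt0 // exprn_gt0.
have [k hk] : exists k, 2 * (s / 2 ^+ k) < r.
  exists (Num.bound (2 * s / r)).
  have q0 : 0 < 2 * s / r by rewrite divr_gt0 // mulr_gt0.
  rewrite mulrA ltr_pdivrMr ?exprn_gt0 // [r * _]mulrC -ltr_pdivrMr //.
  apply: lt_le_trans (archi_boundP (ltW q0)) _.
  by rewrite -natrX ler_nat ltnW // ltn_expl.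
set t := s / 2 ^+ k in hk.
have diam z : square (b k) t z -> normc (z - z0) <= 2 * t.
  move=> [/andP[? ?] /andP[? ?]]; have := z0in k.
  rewrite -/t => -[/andP[/= ? ?] /andP[/= ? ?]].
  apply: le_trans (normc_le_ReIm _) _.
  have -> : Re (z - z0) = Re z - x by case: (z).
  have -> : Im (z - z0) = Im z - y by case: (z).
  rewrite mulr_natl mulr2n.
  by apply: lerD; rewrite ler_norml; apply/andP; split; lra.
have [n _] := badb k 0%N; rewrite -/t ltNge => /negP; apply.
pose g z := f z - f z0 - d * (z - z0).
have -> : f = (fun z => ((f z0 - d * z0) + d * z) + g z).
  by apply/funext => z; rewrite /g; ring.
rewrite (circulationD (fun z => (f z0 - d * z0) + d * z)) circulation_affine add0r.
have t0 : 0 <= t by exact: r0.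
apply: le_trans (circulation_le (M := e / (16 * s ^+ 2) * (2 * t)) _ t0 _) _.
  move=> z /diam zt; apply: le_trans (hr _ (le_lt_trans zt hk)) _.
  by rewrite ler_wpM2l // divr_ge0 ?mulr_ge0 ?exprn_ge0 // ltW.
have -> : (4 : R) ^+ k = 2 ^+ k * 2 ^+ k by rewrite -exprMn; congr (_ ^+ _); ring.
have q0 : 0 < 2 ^+ k :> R by rewrite exprn_gt0.
rewrite /t; move: (2 ^+ k) q0 => q q0.
rewrite (_ : 4 * _ * _ = e / (q * q) / 2); last by field; rewrite !gt_eqF.
rewrite ler_pdivrMr // ler_peMr ?ler1n // ltW // divr_gt0 // mulr_gt0 //.
Qed.

End circulations.

(** * Differentiable functions and their difference quotients *)

Section difference_quotients.
Variable R : realType.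
Implicit Types f : R[i] -> R[i].

Lemma differentiable_has_cderiv f z0 :
  differentiable f z0 -> exists d, has_cderiv f z0 d.
Proof.
move=> /derivable1_diffP /cvg_ex [d /cvgrPdist_le df]; exists d => e e0.
have /df : 0 < e%:C by rewrite ltcR.
move=> -[/= [r1 r2] + near_df].
rewrite ltcE /= => /andP[/eqP r20 r10].
exists r1 => // z zr.
have [->|zz0] := eqVneq z z0.
  by rewrite !subrr mulr0 subr0 normc0 mulr0.
have h0 : z - z0 != 0 by rewrite subr_eq0.
have := near_df (z - z0); rewrite /= sub0r normrN normCE.
rewrite r20 ltcR => /(_ zr h0).
rewrite /= [(_ *: 1 + _)](_ : _ = z); last by rewrite -[_ *: _]/(_ * _) mulr1 subrK.
rewrite normCE lecR => le.
rewrite -[X in normc X](_ : - ((d - (z - z0)^-1 *: (f z - f z0)) * (z - z0)) = _).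
  by rewrite normcN normcM ler_wpM2r // normc_ge0.
by rewrite -[_ *: _]/(_ * _); field.
Qed.

(** At 0, where division by zero gives the right value 0, the difference
    quotient of this function is the square of that of [f]. *)
Lemma differentiable_sqr_quotient f z : differentiable f 0 -> differentiable f z ->
  differentiable (fun z => (f z - f 0) * (f z - f 0) / z) z.
Proof.
move=> df0 dfz; have [->|z0] := eqVneq z 0.
  move: df0 => /derivable1_diffP df; apply/derivable1_diffP.
  rewrite /derivable; apply: (eq_ind _ (fun F => cvg (F @ 0^')) (is_cvgM df df)).
  apply/funext => h; rewrite /GRing.scale /= addr0 mulr1 subrr !mul0r subr0.
  by rewrite mulrACA -mulrA; congr (_ * _); rewrite mulrC.
apply: (@differentiableM _ _ (fun z => (f z - f 0) * (f z - f 0))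
  (fun z => z^-1)); last exact: differentiable_Rinv.
have dB : differentiable (fun z => f z - f 0) z.
  exact: (differentiableB dfz (differentiable_cst (f 0) z)).
exact: (@differentiableM _ _ (fun z => f z - f 0) (fun z => f z - f 0)).
Qed.

Lemma differentiable_quotient f z : z != 0 -> differentiable f z ->
  differentiable (fun z => (f z - f 0) / z) z.
Proof.
move=> z0 df.
apply: (@differentiableM _ _ (fun z => f z - f 0) (fun z => z^-1));
  last exact: differentiable_Rinv.
exact: (differentiableB df (differentiable_cst (f 0) z)).
Qed.

End difference_quotients.

(** * Circulations around a puncture *)

Section puncture.
Variable R : realType.
Local Notation I := ('i%C : R[i]).
Implicit Types (f g p v : R[i] -> R[i]) (a z : R[i]) (r s e : R).
Local Notation corner r := (Complex (- r) (- r) : R[i]).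

Lemma goursat_avoiding v a s : 0 < s ->
  (forall z, z != 0 -> exists d, has_cderiv v z d) ->
  ~ square a s 0 -> vanishing (fun n => circulation v n a s).
Proof.
move=> s0 dv a0; apply: goursat => // z az; apply: dv; apply/eqP => z0.
by apply: a0; rewrite -z0.
Qed.

(** In the square with corner (- r, - r) and side 3 r the origin sits at
    one third of both sides, hence inside a single quarter, where it sits at two
    thirds.  The three other quarters avoid it, so the circulation concentrates
    on that quarter. *)
Lemma goursat_third v r : 0 < r ->
  (forall z, z != 0 -> exists d, has_cderiv v z d) ->
  vanishing (fun n => circulation v n.+1 (corner r) (3 * r)
                      - circulation v n (corner (2 * (r / 2))) (3 * (r / 2))).
Proof.
move=> r0 dv; have s0 : 0 < 3 * r / 2 by lra.
have h1 : vanishing (fun n =>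
    circulation v n (corner r + (3 * r / 2)%:C) (3 * r / 2)).
  by apply: goursat_avoiding => // -[/andP[]]; rewrite ReD /=; lra.
have h2 : vanishing (fun n =>
    circulation v n (corner r + I * (3 * r / 2)%:C) (3 * r / 2)).
  by apply: goursat_avoiding => // -[_ /andP[]]; rewrite ImD Im_iM /=; lra.
have h3 : vanishing (fun n =>
    circulation v n (corner r + (3 * r / 2)%:C + I * (3 * r / 2)%:C) (3 * r / 2)).
  by apply: goursat_avoiding => // -[/andP[]]; rewrite !ReD Re_iM /=; lra.
apply: vanishing_ext (vanishingD (vanishingD h1 h2) h3) => n.
have -> : 2 * (r / 2) = r by field.
by rewrite circulationS [3 * (r / 2)]mulrA; ring.
Qed.

(** The next bisection brings the origin back from two thirds to one third. *)
Lemma goursat_two_thirds v r : 0 < r ->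
  (forall z, z != 0 -> exists d, has_cderiv v z d) ->
  vanishing (fun n => circulation v n.+1 (corner (2 * r)) (3 * r)
                      - circulation v n (corner (r / 2)) (3 * (r / 2))).
Proof.
move=> r0 dv; have s0 : 0 < 3 * r / 2 by lra.
have h1 : vanishing (fun n => circulation v n (corner (2 * r)) (3 * r / 2)).
  by apply: goursat_avoiding => // -[/andP[]] /=; lra.
have h2 : vanishing (fun n =>
    circulation v n (corner (2 * r) + I * (3 * r / 2)%:C) (3 * r / 2)).
  by apply: goursat_avoiding => // -[/andP[]]; rewrite ReD Re_iM /=; lra.
have h3 : vanishing (fun n =>
    circulation v n (corner (2 * r) + (3 * r / 2)%:C) (3 * r / 2)).
  by apply: goursat_avoiding => // -[_ /andP[]]; rewrite !ImD /=; lra.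
apply: vanishing_ext (vanishingD (vanishingD h1 h2) h3) => n.
have -> : corner (r / 2) = corner (2 * r) + (3 * r / 2)%:C + I * (3 * r / 2)%:C.
  apply/eqP; rewrite eq_complex !ReD !ImD Re_iM Im_iM /=.
  by apply/andP; split; apply/eqP; field.
by rewrite circulationS [3 * (r / 2)]mulrA; ring.
Qed.

Lemma goursat_zoom v r k : 0 < r ->
  (forall z, z != 0 -> exists d, has_cderiv v z d) ->
  vanishing (fun n => circulation v (n + k.*2) (corner r) (3 * r)
                      - circulation v n (corner (r / 4 ^+ k)) (3 * (r / 4 ^+ k))).
Proof.
move=> r0 dv; elim: k => [|k IH].
  by move=> e e0; exists 0%N => n _; rewrite addn0 expr0 divr1 subrr normc0 ltW.
set t := r / 4 ^+ k in IH.
have t0 : 0 < t by rewrite divr_gt0 // exprn_gt0.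
have t20 : 0 < t / 2 by rewrite divr_gt0.
have h1 := vanishing_shift 2 IH.
have h2 := vanishing_shift 1 (goursat_third t0 dv).
have h3 := goursat_two_thirds t20 dv.
apply: vanishing_ext (vanishingD (vanishingD h1 h2) h3) => n.
have -> : r / 4 ^+ k.+1 = t / 2 / 2 by rewrite /t exprSr; field; rewrite expf_neq0.
have -> : (n + k.+1.*2 = n + 2 + k.*2)%N by rewrite doubleS addn2 !addnS.
by rewrite addn2 addn1; ring.
Qed.

(** Zooming onto the puncture keeps the limit of the circulation, while the
    bound [K] makes the circulation of a small square at most a multiple of its
    side. *)
Lemma goursat_bounded v r K rho : 0 < r -> 0 < rho ->
  (forall z, z != 0 -> exists d, has_cderiv v z d) ->
  (forall z, normc z < rho -> normc (v z) <= K) ->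
  vanishing (fun n => circulation v n (corner r) (3 * r)).
Proof.
move=> r0 rho0 dv vK e e0.
have K0 : 0 <= K by apply: le_trans (vK 0 _); rewrite ?normc_ge0 // normc0.
(* The first bound puts the square with corner - t, - t and side 3 * t, for
   t = r / 4 ^ k, inside the disc of radius rho; the second one makes its
   circulation, at most 12 * t * K, smaller than e / 2. *)
have [k hk] : exists k, r / 4 ^+ k < Num.min (rho / 4) (e / (24 * (K + 1))).
  set m := Num.min _ _.
  have m0 : 0 < m by rewrite lt_min !divr_gt0 // mulr_gt0 //; lra.
  exists (Num.bound (r / m)).
  have q0 : 0 < r / m by rewrite divr_gt0.
  rewrite ltr_pdivrMr ?exprn_gt0 // mulrC -ltr_pdivrMr //.
  apply: lt_le_trans (archi_boundP (ltW q0)) _.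
  by rewrite -natrX ler_nat ltnW // ltn_expl.
have [|N hN] := goursat_zoom k r0 dv (e := e / 2); first by rewrite divr_gt0.
exists (N + k.*2)%N => n /subnKC <-; set m := (n - _)%N.
rewrite addnAC; have {hN} := hN (N + m)%N (leq_addr _ _).
set t := r / 4 ^+ k in hk *.
set u := circulation _ _ _ _; set w := circulation _ _ _ _ => uw.
have t0 : 0 < t by rewrite divr_gt0 // exprn_gt0.
move: hk; rewrite lt_min => /andP[trho te].
have : normc w <= 4 * (3 * t) * K.
  apply: circulation_le; first by rewrite mulr_ge0 // ltW.
  move=> z [/= /andP[? ?] /andP[? ?]]; apply: vK.
  apply: le_lt_trans (normc_le_ReIm _) _.
  apply: (@le_lt_trans _ _ (2 * t + 2 * t)); last by lra.
  by apply: lerD; rewrite ler_norml; apply/andP; split; lra.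
move: te; rewrite ltr_pdivlMr; last by rewrite mulr_gt0 //; lra.
move=> te wK; have : t * K <= t * (K + 1) by rewrite ler_wpM2l ?ltW // ltrDl.
move=> tK; have := le_normcD (u - w) w; rewrite subrK.
have : 4 * (3 * t) * K = 12 * (t * K) by ring.
have : t * (24 * (K + 1)) = 24 * (t * (K + 1)) by ring.
lra.
Qed.

(** The residue of 1 / z: each of the four sides contributes with a nonnegative
    imaginary part, and on the bottom side, where |z|^2 is at most 5 r^2, the
    integrand has imaginary part at least 1 / (5 r). *)
Lemma Im_circulation_inv n r : 0 < r ->
  3 / 5 <= Im (circulation (fun z => z^-1) n (corner r) (3 * r)).
Proof.
move=> r0.
have bottom :
    1 / (5 * r) <= Im (segment_mean (fun z => z^-1) n (corner r) (3 * r)%:C).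
  apply: (@segment_mean_in _ [set z | - r <= Re z <= 2 * r /\ Im z = - r]
    [set w | 1 / (5 * r) <= Im w]); rewrite /midconvex /= ?ReD ?ImD /=.
  - move=> x y; rewrite Re_half Im_half ReD ImD.
    by move=> [/andP[? ?] ->] [/andP[? ?] ->]; split; [apply/andP; split|]; lra.
  - by move=> x y; rewrite Im_half ImD; lra.
  - move=> z; rewrite Im_inv => -[/andP[? ?] ->].
    rewrite opprK ler_pdivlMr; last by nra.
    rewrite mulrAC mul1r ler_pdivrMr; last by lra.
    nra.
  - by split; [apply/andP; split|]; lra.
  - by split; [apply/andP; split|]; lra.
have right :
    0 <= Re (segment_mean (fun z => z^-1) n (corner r + (3 * r)%:C) (I * (3 * r)%:C)).
  apply: (@segment_mean_in _ [set z | 0 <= Re z] [set w | 0 <= Re w]);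
    rewrite /midconvex /= ?ReD ?Re_iM /=; [ | |  | lra | lra].
  - by move=> x y; rewrite Re_half ReD; lra.
  - by move=> x y; rewrite Re_half ReD; lra.
  - by move=> z zr; rewrite Re_inv divr_ge0 // addr_ge0 ?sqr_ge0.
have top :
    Im (segment_mean (fun z => z^-1) n (corner r + I * (3 * r)%:C) (3 * r)%:C) <= 0.
  apply: (@segment_mean_in _ [set z | 0 <= Im z] [set w | Im w <= 0]);
    rewrite /midconvex /= ?ImD ?Im_iM /=; [ | |  | lra | lra].
  - by move=> x y; rewrite Im_half ImD; lra.
  - by move=> x y; rewrite Im_half ImD; lra.
  - by move=> z zr; rewrite Im_inv mulNr oppr_le0 divr_ge0 // addr_ge0 ?sqr_ge0.
have left : Re (segment_mean (fun z => z^-1) n (corner r) (I * (3 * r)%:C)) <= 0.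
  apply: (@segment_mean_in _ [set z | Re z <= 0] [set w | Re w <= 0]);
    rewrite /midconvex /= ?ReD ?Re_iM /=; [ | |  | lra | lra].
  - by move=> x y; rewrite Re_half ReD; lra.
  - by move=> x y; rewrite Re_half ReD; lra.
  - by move=> z zr; rewrite Re_inv mulr_le0_ge0 // invr_ge0 addr_ge0 ?sqr_ge0.
rewrite /circulation ImM /= mul0r addr0 !ImD !ImN !Im_iM.
have -> : 3 / 5 = 3 * r * (1 / (5 * r)) by field; lra.
rewrite ler_pM2l; lra.
Qed.

Lemma circulation_quotient_le p n r e : 0 < r -> 0 <= e ->
  (forall z, r <= normc z -> normc (p z) <= e) ->
  normc (circulation (fun z => p z * z^-1) n (corner r) (3 * r)) <= 12 * e.
Proof.
move=> r0 e0 pe.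
have qe z : r <= normc z -> normc (p z * z^-1) <= e / r.
  move=> zr; rewrite normcM normcV.
  apply: ler_pM; rewrite ?invr_ge0 ?normc_ge0 ?pe //.
  by rewrite lef_pV2 // posrE // (lt_le_trans r0).
have -> : 12 * e = 3 * r * (e / r + e / r + e / r + e / r) by field; lra.
apply: circulation_le4; first lra.
- apply: (@segment_mean_le _ [set z | Im z <= - r]);
    rewrite /= ?ImD /=; [| |lra|lra].
    by move=> x y /=; rewrite Im_half ImD; lra.
  move=> z zr; apply/qe/(le_trans _ (normc_geIm z)).
  by rewrite ler_normr; apply/orP; right; lra.
- apply: (@segment_mean_le _ [set z | r <= Re z]);
    rewrite /= ?ReD ?Re_iM /=; [| |lra|lra].
    by move=> x y /=; rewrite Re_half ReD; lra.
  move=> z zr; apply/qe/(le_trans _ (normc_geRe z)).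
  by rewrite ler_normr; apply/orP; left; lra.
- apply: (@segment_mean_le _ [set z | r <= Im z]);
    rewrite /= ?ImD ?Im_iM /=; [| |lra|lra].
    by move=> x y /=; rewrite Im_half ImD; lra.
  move=> z zr; apply/qe/(le_trans _ (normc_geIm z)).
  by rewrite ler_normr; apply/orP; left; lra.
- apply: (@segment_mean_le _ [set z | Re z <= - r]);
    rewrite /= ?ReD ?Re_iM /=; [| |lra|lra].
    by move=> x y /=; rewrite Re_half ReD; lra.
  move=> z zr; apply/qe/(le_trans _ (normc_geRe z)).
  by rewrite ler_normr; apply/orP; right; lra.
Qed.

(** On a large square the circulation of (p z - p 0) / z tends to 0 with the
    mesh; that of p z / z is at most 12 times the bound of |p| near
    infinity, and that of 1 / z is at least 3 / 5 in modulus. *)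
Lemma entire_zero p : (forall z, differentiable p z) ->
  (forall e, 0 < e -> exists M, forall z, M <= normc z -> normc (p z) <= e) ->
  p 0 = 0.
Proof.
move=> dp p_infty.
pose v z := (p z - p 0) * z^-1.
have dv z : z != 0 -> exists d, has_cderiv v z d.
  by move=> z0; apply/differentiable_has_cderiv/differentiable_quotient.
have [d pd] := differentiable_has_cderiv (dp 0).
have [rho rho0 prho] := pd 1 ltr01.
have vK z : normc z < rho -> normc (v z) <= normc d + 1.
  rewrite /v; have [->|z0] := eqVneq z 0.
    by rewrite invr0 mulr0 normc0 addr_ge0 ?normc_ge0.
  move=> zr; have := prho z; rewrite subr0 mul1r => /(_ zr) le.
  have zn0 : 0 < normc z.
    by rewrite lt_def normc_ge0 andbT; apply: contra_neq z0 => /eq0_normc.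
  rewrite normcM normcV ler_pdivrMr // mulrDl mul1r -normcM.
  have := le_normcD (p z - p 0 - d * z) (d * z); rewrite subrK; lra.
apply: eq0_normc; apply/eqP; rewrite eq_le normc_ge0 andbT.
apply/ler_addgt0Pl => e e0; rewrite addr0.
(* With d this constant, 3 / 5 * |p 0| is at most 12 * d + d = 3 / 5 * e. *)
have e1 : 0 < 3 / 65 * e by lra.
have [M pM] := p_infty _ e1.
pose r := `|M| + 1.
have r0 : 0 < r by rewrite /r ltr_pwDr.
have [|N vN] := goursat_bounded r0 rho0 dv vK (e := 3 / 65 * e); first by [].
have {vN} := vN N (leqnn _).
have -> : v = fun z => p z * z^-1 + - p 0 * z^-1.
  by apply/funext => z; rewrite /v mulrBl mulNr.
rewrite (circulationD (fun z => p z * z^-1)) circulationZ.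
have {pM} pM z : r <= normc z -> normc (p z) <= 3 / 65 * e.
  move=> rz; apply: pM; apply: le_trans rz; rewrite /r.
  have := ler_norm M; lra.
have := circulation_quotient_le N r0 (ltW e1) pM.
have := Im_circulation_inv N r0.
set X := circulation _ _ _ _.
set Y := circulation (fun z => p z * z^-1) _ _ _ => hX hY hXY.
have := le_normcD (- (Y + - p 0 * X)) Y.
rewrite normcN (_ : - (Y + - p 0 * X) + Y = p 0 * X); last by ring.
rewrite normcM => le.
have : 3 / 5 * normc (p 0) <= normc (p 0) * normc X.
  rewrite mulrC ler_wpM2l ?normc_ge0 //; apply: (le_trans hX).
  by apply: (le_trans _ (normc_geIm X)); exact: ler_norm.
lra.
Qed.

End puncture.

(** * Liouville's theorem *)

Section liouville.
Variable R : realType.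
Implicit Types (f p : R[i] -> R[i]) (e : R).

Lemma entire_zero_at p b : (forall z, differentiable p z) ->
  (forall e, 0 < e -> exists M, forall z, M <= normc z -> normc (p z) <= e) ->
  p b = 0.
Proof.
move=> dp p_infty; have := @entire_zero R (fun z => p (z + b)); rewrite add0r; apply.
  move=> z; apply: (@differentiable_comp _ _ _ _ (fun z => z + b) p); last exact: dp.
  apply: (@differentiableD _ _ _ id (cst b)); first exact: ex_diff.
  exact: differentiable_cst.
move=> e /p_infty[M pM]; exists (M + normc b) => z zM; apply: pM.
have := le_normcD (z + b) (- b); rewrite addrK normcN; lra.
Qed.

(** The square in (f z - f 0)^2 / z makes this function differentiable at 0
    as soon as [f] is; for (f z - f 0) / z that would take a second derivative
    of [f]. *)
Theorem liouville f (M : R) : (forall z, differentiable f z) ->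
  (forall z, normc (f z) <= M) -> forall z, f z = f 0.
Proof.
move=> df fM z; have [->//|z0] := eqVneq z 0.
pose p z := (f z - f 0) * (f z - f 0) / z.
suff : p z = 0.
  rewrite /p => /eqP; rewrite !mulf_eq0 invr_eq0 (negPf z0) orbF orbb subr_eq0.
  by move=> /eqP ->; reflexivity.
have M0 : 0 <= M by exact: le_trans (normc_ge0 _) (fM 0).
apply: entire_zero_at => [w|e e0]; first exact: differentiable_sqr_quotient.
exists (4 * M ^+ 2 / e + 1) => w wM.
have M20 : 0 <= 4 * M ^+ 2 / e by apply: divr_ge0; [nra|exact: ltW].
have w0 : 0 < normc w by lra.
rewrite /p !normcM normcV ler_pdivrMr //.
have fw : normc (f w - f 0) <= 2 * M.
  apply: le_trans (le_normcD _ _) _; rewrite normcN.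
  by have := fM w; have := fM 0; lra.
apply: (@le_trans _ _ (4 * M ^+ 2)).
  have -> : 4 * M ^+ 2 = (2 * M) * (2 * M) by ring.
  by apply: ler_pM; rewrite ?normc_ge0.
by rewrite [e * _]mulrC -ler_pdivrMr //; lra.
Qed.

End liouville.

(** * Maps of C^4 and the obstruction to boundedness *)

Section complex_lines.
Variable R : realType.

Definition vec4 (a b c d : R[i]) : 'rV[R[i]]_4 := \row_i nth 0 [:: a; b; c; d] i.

Lemma vec4E a b c d : (vec4 a b c d 0 0 = a) * (vec4 a b c d 0 1 = b) *
  (vec4 a b c d 0 2 = c) * (vec4 a b c d 0 3 = d).
Proof. by rewrite /vec4 !mxE. Qed.

Lemma vec4_eta (z : 'rV[R[i]]_4) : vec4 (z 0 0) (z 0 1) (z 0 2) (z 0 3) = z.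
Proof.
by apply/rowP => -[[|[|[|[|//]]]] ilt]; rewrite mxE /=; congr (z _ _); apply/val_inj.
Qed.

Lemma differentiable_vec4 (V : normedModType R[i]) (a b c d : V -> R[i]) (z : V) :
  differentiable a z -> differentiable b z ->
  differentiable c z -> differentiable d z ->
  differentiable (fun z => vec4 (a z) (b z) (c z) (d z)) z.
Proof.
move=> da db dc dd.
have -> : (fun z => vec4 (a z) (b z) (c z) (d z)) =
   (fun z => a z *: vec4 1 0 0 0) + (fun z => b z *: vec4 0 1 0 0)
   + (fun z => c z *: vec4 0 0 1 0) + (fun z => d z *: vec4 0 0 0 1).
  apply/funext => w; apply/rowP => -[[|[|[|[|//]]]] ilt];
    by rewrite !fctE !mxE /=; ring.
by apply: differentiableD; [apply: differentiableD; [apply: differentiableD|]|];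
  apply: differentiableZl.
Qed.

Lemma coord_le_norm (m n : nat) (A : 'M[R[i]]_(m, n)) (i : 'I_m) (j : 'I_n) :
  `|A i j| <= `|A|.
Proof.
rewrite [leRHS]/Num.Def.normr /= mx_normE.
rewrite -[leLHS]nngE num_le.
exact: (le_bigmax _ (fun k : 'I_m * 'I_n => `|A k.1 k.2|%:nng) (i, j)).
Qed.

(** Each coordinate of a biholomorphism, restricted to the line
    z |-> (0, z, 0, d), is a bounded entire function. *)
Lemma bounded_not_biholomorphic (D : set 'rV[R[i]]_4) (d : R[i])
    n (U : set 'rV[R[i]]_n) : (forall z, D (vec4 0 z 0 d)) ->
  bounded_set U -> ~ biholomorphic D U.
Proof.
move=> lineD [M [Mreal UM]] [f [[fDU injf _] [df _]]].
have const j z : f (vec4 0 z 0 d) 0 j = f (vec4 0 0 0 d) 0 j.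
  apply: (@liouville _ (fun z => f (vec4 0 z 0 d) 0 j) (normc (M + 1))) => w.
    apply: (@differentiable_comp _ _ _ _ (fun z : R[i] => vec4 0 z 0 d)
      (fun v : 'rV[R[i]]_4 => f v 0 j)).
      apply: differentiable_vec4; first exact: differentiable_cst.
      - exact: ex_diff.
      - exact: differentiable_cst.
      - exact: differentiable_cst.
    apply: (@differentiable_comp _ _ _ _ f (fun v : 'rV[R[i]]_n => v 0 j));
      first exact/df/lineD.
    exact: differentiable_coord.
  have M1 : M < M + 1 by rewrite ltrDl.
  have := UM _ M1 (f (vec4 0 w 0 d)) (fDU _ (lineD w)).
  move=> /(le_trans (coord_le_norm _ 0 j)) le.
  have M10 : 0 <= M + 1 by exact: le_trans (normr_ge0 _) le.
  by move: le; rewrite -[M + 1 in leRHS]ger0_norm // !normCE lecR.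
have : vec4 0 1 0 d = vec4 0 0 0 d.
  by apply: injf; rewrite ?inE //; apply/rowP => j.
by move=> /rowP/(_ 1); rewrite !vec4E => /eqP; rewrite oner_eq0.
Qed.

End complex_lines.

(** * Automorphisms acting on the height *)

Section model_domains.
Variable R : realType.
Local Notation I := ('i%C : R[i]).
Local Notation C4 := 'rV[R[i]]_4.

Definition height (e : R) (z : C4) : R := Re (z 0 3)
  - ((Re (z 0 0) * Re (z 0 1) + Im (z 0 0) * Im (z 0 1)) *+ 2
     + (Re (z 0 2) ^+ 2 + Im (z 0 2) ^+ 2)
     + e * (Re (z 0 0) ^+ 2 + Im (z 0 0) ^+ 2) ^+ 2).

Lemma model_rhsE (e : R) (z : C4) :
  'Re (z 0 3) - model_rhs e%:C z = (height e z)%:C.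
Proof.
rewrite /model_rhs -complexRe [`|z 0 0| ^+ 4](exprM _ 2 2) -!add_Re2_Im2.
rewrite [z 0 0 * _ + _](_ : _ =
  ((Re (z 0 0) * Re (z 0 1) + Im (z 0 0) * Im (z 0 1)) *+ 2)%:C); last first.
  case: (z 0 0) => a b; case: (z 0 1) => c d; apply/eqP; rewrite eq_complex /=.
  by apply/andP; split; apply/eqP; ring.
by rewrite -rmorphXn -rmorphM -!rmorphD -rmorphB.
Qed.

Lemma DgtE e : Dgt e%:C = [set z | 0 < height e z].
Proof.
by apply/seteqP; split => z; rewrite /Dgt /= -ltcR -model_rhsE subr_gt0.
Qed.

Lemma DltE e : Dlt e%:C = [set z | height e z < 0].
Proof.
by apply/seteqP; split => z; rewrite /Dlt /= -ltcR -model_rhsE subr_lt0.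
Qed.

(** Carrying the inverse [g] along makes these maps closed under composition
    and inversion without any further argument. *)
Definition level_automorphism e (t : R) (f g : C4 -> C4) :=
  [/\ forall z, differentiable f z, forall z, differentiable g z,
      cancel f g, cancel g f & forall z, height e (f z) = t * height e z].

Lemma level_automorphismV e t f g : 0 < t ->
  level_automorphism e t f g -> level_automorphism e t^-1 g f.
Proof.
move=> t0 [df dg fK gK h]; split=> // z.
by rewrite -[in RHS](gK z) h mulKf // gt_eqF.
Qed.

Lemma level_automorphism_comp e t f g t' f' g' :
  level_automorphism e t f g -> level_automorphism e t' f' g' ->
  level_automorphism e (t * t') (f \o f') (g' \o g).
Proof.
move=> [df dg fK gK h] [df' dg' fK' gK' h']; split.
- by move=> z; apply: differentiable_comp.
- by move=> z; apply: differentiable_comp.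
- exact: can_comp.
- exact: can_comp.
- by move=> z; rewrite /= h h' mulrA.
Qed.

Lemma level_automorphism_biholo e t f g (S : set R) :
  level_automorphism e t f g -> (forall x, S (t * x) <-> S x) ->
  biholomorphism [set z | S (height e z)] [set z | S (height e z)] f.
Proof.
move=> [df dg fK gK h] St; split; last first.
  by split=> [z _ //|]; exists g; split=> [z _|z _].
split=> [z /=|z w _ _ /(can_inj fK)//|z /= Sz]; first by rewrite h St.
by exists (g z) => //=; rewrite -St -h gK.
Qed.

Lemma differentiable_entry i (z : C4) : differentiable (fun z : C4 => z 0 i) z.
Proof. exact: differentiable_coord. Qed.

(** The rules for sums and products of functions do not unify with the
    pointwise expressions that make up a polynomial map; these forms do. *)
Lemma differentiable_add (V : normedModType R[i]) (f g : V -> R[i]) z :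
  differentiable f z -> differentiable g z ->
  differentiable (fun z => f z + g z) z.
Proof. exact: differentiableD. Qed.

Lemma differentiable_sub (V : normedModType R[i]) (f g : V -> R[i]) z :
  differentiable f z -> differentiable g z ->
  differentiable (fun z => f z - g z) z.
Proof. exact: differentiableB. Qed.

Lemma differentiable_mul (V : normedModType R[i]) (f g : V -> R[i]) z :
  differentiable f z -> differentiable g z ->
  differentiable (fun z => f z * g z) z.
Proof. exact: differentiableM. Qed.

Lemma differentiable_const (V : normedModType R[i]) (c : R[i]) (z : V) :
  differentiable (fun=> c) z.
Proof. exact: differentiable_cst. Qed.

(** Replacing z_1 by z_1 + a changes e |z_1|^4 by the real part of
    2 e (conj a z_1)^2 + 4 e |a|^2 conj a z_1 + e |a|^4, which goes into z_4,
    plus 4 e |z_1|^2 Re (conj a z_1) + 4 e |a|^2 |z_1|^2, which is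
    twice the real part of conj z_1 times 2 e conj a (z_1^2 + a z_1).  The new
    second coordinate [k] subtracts this factor.  The remaining cross term
    2 Re (a conj k) = Re (2 conj a k) goes into z_4 too. *)
Definition shear (e : R) (a : R[i]) (z : C4) : C4 :=
  let k := z 0 1 - (2 * e)%:C * a^*%C * (z 0 0 * z 0 0 + a * z 0 0) in
  vec4 (z 0 0 + a) k (z 0 2)
    (z 0 3 + 2%:C * a^*%C * k +
     e%:C * a^*%C * (2%:C * a^*%C * (z 0 0 * z 0 0)
                     + 4%:C * a * a^*%C * z 0 0 + a * a * a^*%C)).

Definition translation (b c : R[i]) (y : R) (z : C4) : C4 :=
  vec4 (z 0 0) (z 0 1 + b) (z 0 2 + c)
    (z 0 3 + 2%:C * b^*%C * z 0 0 + 2%:C * c^*%C * z 0 2 + c * c^*%C + I * y%:C).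

Definition dilation (s : R) (z : C4) : C4 :=
  vec4 (s%:C * z 0 0) ((s ^+ 3)%:C * z 0 1)
    ((s ^+ 2)%:C * z 0 2) ((s ^+ 4)%:C * z 0 3).

Ltac diff_poly :=
  lazymatch goal with
  | |- differentiable (fun z => vec4 _ _ _ _) _ =>
      apply: differentiable_vec4; diff_poly
  | |- differentiable (fun z => _ + - _) _ => apply: differentiable_sub; diff_poly
  | |- differentiable (fun z => _ + _) _ => apply: differentiable_add; diff_poly
  | |- differentiable (fun z => _ * _) _ => apply: differentiable_mul; diff_poly
  | |- differentiable (fun z => fun_of_matrix z 0 _) _ =>
      apply: differentiable_entry
  | |- _ => apply: differentiable_const
  end.

Lemma differentiable_shear e a z : differentiable (shear e a) z.
Proof. by rewrite /shear /=; diff_poly. Qed.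

Lemma differentiable_translation b c y z : differentiable (translation b c y) z.
Proof. by rewrite /translation; diff_poly. Qed.

Lemma differentiable_dilation s z : differentiable (dilation s) z.
Proof. by rewrite /dilation; diff_poly. Qed.

Lemma shearK e a : cancel (shear e a) (shear e (- a)).
Proof.
move=> z; rewrite -[RHS]vec4_eta /shear /= !vec4E rmorphN.
by congr vec4; ring.
Qed.

Lemma translationK b c y :
  cancel (translation b c y) (translation (- b) (- c) (- y)).
Proof.
move=> z; rewrite -[RHS]vec4_eta /translation /= !vec4E !rmorphN.
by congr vec4; ring.
Qed.

Lemma dilationK s : s != 0 -> cancel (dilation s) (dilation s^-1).
Proof.
move=> s0 z; rewrite -[RHS]vec4_eta /dilation /= !vec4E !mulrA -!rmorphM.
by rewrite -!exprMn mulVf // !expr1n !rmorph1 !mul1r.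
Qed.

Lemma height_shear e a z : height e (shear e a z) = height e z.
Proof.
rewrite /height /shear !vec4E.
move: (z 0 0) (z 0 1) (z 0 2) (z 0 3) a.
by move=> [x0 y0] [x1 y1] [x2 y2] [x3 y3] [u v] /=; ring.
Qed.

Lemma height_translation e b c y z : height e (translation b c y z) = height e z.
Proof.
rewrite /height /translation !vec4E.
move: (z 0 0) (z 0 1) (z 0 2) (z 0 3) b c.
by move=> [x0 y0] [x1 y1] [x2 y2] [x3 y3] [u v] [p q] /=; ring.
Qed.

Lemma height_dilation e s z : height e (dilation s z) = s ^+ 4 * height e z.
Proof.
rewrite /height /dilation !vec4E.
by move: (z 0 0) (z 0 1) (z 0 2) (z 0 3) => [x0 y0] [x1 y1] [x2 y2] [x3 y3] /=; ring.
Qed.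

(** The shear kills z_1, then the translation kills z_2, z_3 and the
    imaginary part of z_4; as the height has not changed, it is what remains. *)
Lemma normal_form e p : exists f g,
  level_automorphism e 1 f g /\ f p = vec4 0 0 0 (height e p)%:C.
Proof.
pose q := shear e (- p 0 0) p.
pose r := translation (- q 0 1) (- q 0 2) 0 q.
(* [r] still carries an imaginary part in z_4, which [y] cancels. *)
pose y := - Im (r 0 3).
exists (translation (- q 0 1) (- q 0 2) y \o shear e (- p 0 0)).
exists (shear e (p 0 0) \o translation (q 0 1) (q 0 2) (- y)).
split.
  rewrite -[1](mulr1 1); apply: level_automorphism_comp; split.
  - exact: differentiable_translation.
  - exact: differentiable_translation.
  - by have := translationK (- q 0 1) (- q 0 2) y; rewrite !opprK.
  - by have := translationK (q 0 1) (q 0 2) (- y); rewrite !opprK.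
  - by move=> z; rewrite height_translation mul1r.
  - exact: differentiable_shear.
  - exact: differentiable_shear.
  - by have := shearK e (- p 0 0); rewrite opprK.
  - exact: shearK.
  - by move=> z; rewrite height_shear mul1r.
rewrite /= -/q; set w := translation _ _ _ _.
have q0 : q 0 0 = 0 by rewrite /q /shear vec4E subrr.
have w0 : w 0 0 = 0 by rewrite /w /translation vec4E.
have w1 : w 0 1 = 0 by rewrite /w /translation vec4E subrr.
have w2 : w 0 2 = 0 by rewrite /w /translation vec4E subrr.
have w3 : w 0 3 = r 0 3 + I * y%:C.
  by rewrite /r /w /translation !vec4E mulr0 addr0.
have <- : height e w = height e p by rewrite height_translation height_shear.
rewrite -[LHS]vec4_eta w0 w1 w2; congr vec4; apply/eqP; rewrite eq_complex.
apply/andP; split; apply/eqP.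
  by rewrite /height w0 w2 /=; ring.
by rewrite w3 ImD Im_iM /= /y subrr.
Qed.

(** Only the ratio of the heights matters: a fourth root [s] of it exists because
    it is positive, and the dilation by [s] joins the two normal forms. *)
Lemma homogeneous_height e (S : set R) :
  (forall x y, S x -> S y -> 0 < y / x /\ forall z, S (y / x * z) <-> S z) ->
  forall p q, S (height e p) -> S (height e q) ->
  exists2 f, biholomorphism [set z | S (height e z)] [set z | S (height e z)] f &
    f p = q.
Proof.
move=> hS p q Sp Sq.
have [t0 St] := hS _ _ Sp Sq.
have [f [g [fg fp]]] := normal_form e p.
have [f' [g' [fg' fq]]] := normal_form e q.
pose t := height e q / height e p; pose s := Num.sqrt (Num.sqrt t).
have s0 : s != 0 by rewrite gt_eqF // !sqrtr_gt0.
have s4 : s ^+ 4 = t.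
  by rewrite (exprM _ 2 2) !sqr_sqrtr ?sqrtr_ge0 // ltW.
have dil : level_automorphism e t (dilation s) (dilation s^-1).
  split; [exact: differentiable_dilation|exact: differentiable_dilation
    |exact: dilationK| |by move=> z; rewrite height_dilation s4].
  by have := dilationK (s := s^-1); rewrite invr_eq0 invrK => /(_ s0).
have := level_automorphism_comp (level_automorphismV ltr01 fg')
  (level_automorphism_comp dil fg).
rewrite invr1 mul1r mulr1 => aut.
exists (g' \o (dilation s \o f)); first exact: level_automorphism_biholo aut St.
rewrite /= fp.
have -> : dilation s (vec4 0 0 0 (height e p)%:C) = vec4 0 0 0 (height e q)%:C.
  rewrite /dilation !vec4E !mulr0 s4 -rmorphM /t divfK //.
  by apply: contraTneq t0 => ->; rewrite invr0 mulr0 ltxx.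
by rewrite -fq; have [_ _ fK _ _] := fg'; rewrite fK.
Qed.

(** * Topology of the domains *)

Lemma continuous_Re : continuous (@complex.Re R).
Proof.
move=> z; apply: (iffRL (@cvgrPdist_lt _ _ _ (nbhs (z : R[i])) _ _ _)) => e e0.
have ze : nbhs z (ball z e%:C) by apply: nbhsx_ballx; rewrite ltcR.
apply: filterS ze => w; rewrite /ball /= normCE ltcR; apply: le_lt_trans.
by rewrite -ReN -ReD normc_geRe.
Qed.

Lemma continuous_Im : continuous (@complex.Im R).
Proof.
move=> z; apply: (iffRL (@cvgrPdist_lt _ _ _ (nbhs (z : R[i])) _ _ _)) => e e0.
have ze : nbhs z (ball z e%:C) by apply: nbhsx_ballx; rewrite ltcR.
apply: filterS ze => w; rewrite /ball /= normCE ltcR; apply: le_lt_trans.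
by rewrite -ImN -ImD normc_geIm.
Qed.

Lemma continuous_real_complex : continuous (fun x : R => x%:C).
Proof.
move=> x; apply: (iffRL (@cvgrPdist_lt _ _ _ (nbhs (x : R)) _ _ _)) => e.
rewrite ltcE /= => /andP[/eqP e0 e1].
have xe : nbhs x (ball x (Re e)) by exact: nbhsx_ballx.
apply: filterS xe => y; rewrite /ball /= => xy; rewrite -rmorphB normCE normc_real.
by case: e e0 e1 xy => a b /= -> _ ?; rewrite ltcR.
Qed.

Lemma continuous_add (T : topologicalType) (f g : T -> R) :
  continuous f -> continuous g -> continuous (fun z => f z + g z).
Proof. by move=> cf cg z; apply: (continuousD (cf z) (cg z)). Qed.

Lemma continuous_sub (T : topologicalType) (f g : T -> R) :
  continuous f -> continuous g -> continuous (fun z => f z - g z).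
Proof. by move=> cf cg z; apply: (continuousB (cf z) (cg z)). Qed.

Lemma continuous_mul (T : topologicalType) (f g : T -> R) :
  continuous f -> continuous g -> continuous (fun z => f z * g z).
Proof. by move=> cf cg z; apply: (continuousM (cf z) (cg z)). Qed.

Lemma continuous_height (e : R) : continuous (height e).
Proof.
have cRe i : continuous (fun z : C4 => Re (z 0 i)).
  by move=> z; apply: continuous_comp; [exact: coord_continuous|exact: continuous_Re].
have cIm i : continuous (fun z : C4 => Im (z 0 i)).
  by move=> z; apply: continuous_comp; [exact: coord_continuous|exact: continuous_Im].
have csq (f : C4 -> R) : continuous f -> continuous (fun z => f z ^+ 2).
  by move=> cf; apply: continuous_mul.
have cdbl (f : C4 -> R) : continuous f -> continuous (fun z => f z *+ 2).
  by move=> cf; apply: continuous_add.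
apply: continuous_sub; first exact: cRe.
apply: continuous_add.
  apply: continuous_add.
    by apply: cdbl; apply: continuous_add; apply: continuous_mul.
  by apply: continuous_add; apply: csq.
apply: continuous_mul; first exact: cst_continuous.
by apply/csq/continuous_add; apply: csq.
Qed.

Lemma open_height e (S : set R) : open S -> open [set z | S (height e z)].
Proof. by move=> oS; apply: open_comp => // z _; exact: continuous_height. Qed.

Lemma height_vertical e z (c : R) :
  height e (z + c%:C *: vec4 0 0 0 1) = height e z + c.
Proof.
rewrite /height !mxE /= !mulr0 !addr0 mulr1 ReD /=; ring.
Qed.

(** The height is not affine, but adding a real number to z_4 adds it to the
    height.  Correcting the straight path from p to q in this way gives a path
    along which the height is the affine interpolation of its end values, which
    stays in the interval [S]. *)
Lemma connected_height e (S : set R) : is_interval S ->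
  connected [set z | S (height e z)].
Proof.
move=> iS.
have [->|/set0P[p /= Sp]] := eqVneq [set z | S (height e z)] set0.
  exact: connected0.
pose line q (t : R) : C4 := p + t%:C *: (q - p).
pose corr q t := height e p + t * (height e q - height e p) - height e (line q t).
pose path q t := line q t + (corr q t)%:C *: vec4 0 0 0 1.
have cline q : continuous (line q).
  move=> t; apply: cvgD; first exact: cvg_cst.
  by apply: cvgZr_tmp; exact: continuous_real_complex.
have cpath q : continuous (path q).
  move=> t; apply: cvgD; first exact: cline.
  apply: cvgZr_tmp; apply: continuous_comp; last exact: continuous_real_complex.
  apply: cvgB; last first.
    by apply: continuous_comp; [exact: cline|exact: continuous_height].
  by apply: cvgD; [exact: cvg_cst|apply: cvgM; [exact: cvg_id|exact: cvg_cst]].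
have hpath q t : height e (path q t) = height e p + t * (height e q - height e p).
  by rewrite /path height_vertical /corr; ring.
have -> : [set z | S (height e z)] =
    \bigcup_(q in [set z | S (height e z)]) (path q @` `[0, 1]).
  apply/seteqP; split=> [q Sq|_ [q Sq [t t01 <-]]] /=.
    exists q => //; exists 1; first by rewrite /= in_itv /= ler01 lexx.
    rewrite /path /corr /line scale1r subrKC mul1r addrCA subrr addr0 subrr.
    by rewrite scale0r addr0.
  rewrite hpath; move: t01; rewrite /= in_itv /= => /andP[t0 t1].
  have [le|/ltW le] := leP (height e p) (height e q).
    by apply: (iS _ _ Sp Sq); apply/andP; split; nra.
  by apply: (iS _ _ Sq Sp); apply/andP; split; nra.
apply: bigcup_connected.
  exists p => q Sq; exists 0; first by rewrite /= in_itv /= ler01 lexx.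
  by rewrite /path /corr /line scale0r addr0 mul0r addr0 subrr scale0r addr0.
move=> q _; apply: connected_continuous_connected; first exact: segment_connected.
exact/continuous_subspaceT/cpath.
Qed.

(** Both rays are treated at once: [sigma] is 1 for the domains above the
    hypersurface and -1 for those below. *)
Lemma ray_domain (e sigma : R) : sigma != 0 ->
  let D := [set z : C4 | 0 < sigma * height e z] in
  holomorphically_homogeneous D /\
  (forall (n : nat) (U : set 'rV[R[i]]_n),
     is_domain U -> bounded_set U -> ~ biholomorphic D U).
Proof.
move=> sigma0 D; pose S : set R := [set x | 0 < sigma * x].
have height_line z : height e (vec4 0 z 0 sigma%:C) = sigma.
  by rewrite /height !vec4E /=; ring.
have lineD z : D (vec4 0 z 0 sigma%:C).
  by rewrite /D /= height_line -expr2 exprn_even_gt0.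
split; last first.
  by move=> n U _ bU; apply: (bounded_not_biholomorphic lineD bU).
split; first split.
- by exists (vec4 0 0 0 sigma%:C).
- apply: (@open_height e S); apply: (@open_comp _ _ ( *%R sigma) [set x | 0 < x]).
    by move=> x _; apply: mulrl_continuous.
  exact: open_gt.
- apply: (@connected_height e S) => x y; rewrite /S /= => sx sy z /andP[xz zy].
  have [sg0|sl0|/eqP] := ltgtP 0 sigma; last by rewrite eq_sym (negPf sigma0).
    by apply: lt_le_trans sx _; rewrite ler_pM2l.
  by apply: lt_le_trans sy _; rewrite ler_nM2l.
- apply: (@homogeneous_height e S) => x y; rewrite /S /= => sx sy.
  have t0 : 0 < y / x.
    have x0 : x != 0 by apply: contraTneq sx => ->; rewrite mulr0 ltxx.
    rewrite (_ : y / x = sigma * y / (sigma * x)) ?divr_gt0 //.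
    by field; rewrite sigma0 x0.
  by split=> // z; rewrite mulrCA pmulr_rgt0.
Qed.
End model_domains.

Theorem theorem1p1 (R : realType) (D : set 'rV[R[i]]_4)
    (hD : [\/ D = Dgt 1, D = Dgt (-1), D = Dlt 1 | D = Dlt (-1)]) :
  holomorphically_homogeneous D /\
  (forall (n : nat) (U : set 'rV[R[i]]_n),
     is_domain U -> bounded_set U -> ~ biholomorphic D U).
Proof.
suff [e [sigma [sigma0 ->]]] : exists e sigma : R,
    sigma != 0 /\ D = [set z | 0 < sigma * height e z].
  exact: ray_domain.
have above (e : R) : Dgt e%:C = [set z | 0 < 1 * height e z].
  by rewrite DgtE; apply/seteqP; split => z /=; rewrite mul1r.
have below (e : R) : Dlt e%:C = [set z | 0 < -1 * height e z].
  by rewrite DltE; apply/seteqP; split => z /=; rewrite mulN1r oppr_gt0.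
have N10 : (-1 : R) != 0 by rewrite oppr_eq0 oner_eq0.
case: hD => ->.
- by exists 1, 1; rewrite oner_eq0 -above rmorph1.
- by exists (-1), 1; rewrite oner_eq0 -above rmorphN1.
- by exists 1, (-1); rewrite N10 -below rmorph1.
- by exists (-1), (-1); rewrite N10 -below rmorphN1.
Qed.
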